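(* Let $\bar{\mathbb{F}}$ be an algebraically closed field. Every non-commutative sequence of $2\times 2$ matrices over $\bar{\mathbb{F}}$ can be put in canonical form. More precisely, after rearranging its terms, any non-commutative sequence is similar to a sequence $(A_1,A_2,A_3,\dots)$ in canonical form with $A_1,A_2$ and (when present) $A_3$ as described by one of the following cases. Stable case (the sequence is stable): 1.a: $\sigma_{12}\neq 0$, $\delta_1\neq 0$; then $A_1$ is diagonal and $b_2=1$. 1.b: $\sigma_{12}\neq 0$, $\delta_1=\delta_2=0$; then $A_1$ is a Jordan block and $b_2=1$. 1.c: $\sigma_{12}=\sigma_{13}=\sigma_{23}=0$, $\Delta_{123}\neq 0$; then $A_1$ is diagonal and $b_2=1$. Triangularizable case (the sequence is triangularizable): 2.a: all terms are diagonalizable; then $A_1$ is diagonal and $b_2=1$. 2.b: one term, $A_2$, is non-diagonalizable; then $A_1$ is diagonal and $A_2$ is a Jordan block.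
   Context: A matrix sequence is a finite or countably infinite sequence $\mathcal{A}=(A_1,A_2,\dots)$ of $2\times 2$ matrices over $\bar{\mathbb{F}}$, of length $n\ge 2$, with $A_j=\begin{pmatrix} a_j & b_j\\ c_j & d_j\end{pmatrix}$. It is commutative if all its terms pairwise commute, and non-commutative otherwise. $GL_2(\bar{\mathbb{F}})$ acts by simultaneous conjugation $g\cdot\mathcal{A}=(gA_1g^{-1},gA_2g^{-1},\dots)$; two sequences are similar if they are in the same orbit. $\mathcal{A}$ is upper triangular if all terms are upper triangular, and triangularizable if it is similar to an upper triangular sequence. $\mathcal{A}$ is stable (also called irreducible) if, for the conjugation action of $SL_2(\bar{\mathbb{F}})$, the orbit map $g\mapsto g\cdot\mathcal{A}$ is proper, i.e. the orbit is Zariski closed and the stabilizer is finite; equivalently, $\mathcal{A}$ is not triangularizable. A stable sequence is in (stable) canonical form if $A_1$ is in Jordan canonical form and $b_2=1$. A triangularizable sequence is in (triangular) canonical form if it is upper triangular, $A_1$ is diagonal and $b_2=1$. A Jordan block is a matrix $\begin{pmatrix}\lambda&1\\0&\lambda\end{pmatrix}$. Notation: $\sigma_{jk}=\det(A_jA_k-A_kA_j)$; $\Delta_{jkl}=\left(\mathrm{tr}(A_jA_kA_l-A_lA_kA_j)\right)^2$; $\delta_j=(\mathrm{tr}A_j)^2-4\det A_j$ is the discriminant of the characteristic polynomial of $A_j$. *)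

(* Defs.v *)
From HB Require Import structures.
From mathcomp Require Import all_boot all_order all_algebra.
From mathcomp Require Import mpoly.

Set Implicit Arguments.
Unset Strict Implicit.
Unset Printing Implicit Defensive.

Import GRing.Theory.
Local Open Scope ring_scope.

(* A length is [Some n] (finite) or [None] (countably infinite). *)
Definition length_ge (N : option nat) (k : nat) : bool :=
  if N is Some n then (k <= n)%N else true.

(* Positions are numbered from 1, so that [term A j] below is A_j. *)
Definition position (N : option nat) : Type :=
  {j : nat | (0 < j)%N && length_ge N j}.

Definition mxseq (F : closedFieldType) (N : option nat) : Type :=
  position N -> 'M[F]_2.

Section MatrixSequences.
Variables (F : closedFieldType) (N : option nat).
Implicit Types (A B : mxseq F N) (M : 'M[F]_2).

(* The value 0 at a position j outside the sequence is a dummy. *)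
Definition term A (j : nat) : 'M[F]_2 :=
  if insub j is Some i then A i else 0.

Definition commutative_seq A : Prop := forall i j, comm_mx (A i) (A j).

Definition conj_seq (g : 'M[F]_2) A : mxseq F N :=
  fun i => g *m A i *m invmx g.

Definition similar_seq A B : Prop :=
  exists2 g : 'M[F]_2, g \in unitmx & conj_seq g A =1 B.

Definition rearrangement A B : Prop :=
  exists2 s : position N -> position N, bijective s & B =1 A \o s.

Definition upper_triangular M : bool := is_trig_mx M^T.

Definition upper_triangular_seq A : Prop := forall i, upper_triangular (A i).

Definition triangularizable A : Prop :=
  exists2 B, similar_seq A B & upper_triangular_seq B.

(* The Zariski topology on the affine space of all sequences of length N. A
   polynomial function involves only finitely many of the (possibly infinitely
   many) matrix entries: the m-th variable of p is the entry x m, given as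
   ((position, row), column). *)
Definition polynomial_function (f : mxseq F N -> F) : Prop :=
  exists (k : nat) (p : {mpoly F[k]}) (x : 'I_k -> position N * 'I_2 * 'I_2),
    forall A, f A = p.@[fun m => A (x m).1.1 (x m).1.2 (x m).2].

Definition zariski_closed (Z : mxseq F N -> Prop) : Prop :=
  exists2 S : (mxseq F N -> F) -> Prop,
    forall f, S f -> polynomial_function f &
    forall A, Z A <-> (forall f, S f -> f A = 0).

Definition SL2_orbit A B : Prop :=
  exists2 g : 'M[F]_2, \det g = 1 & conj_seq g A =1 B.

Definition SL2_stabilizer A (g : 'M[F]_2) : Prop :=
  \det g = 1 /\ conj_seq g A =1 A.

Definition stable A : Prop :=
  zariski_closed (SL2_orbit A) /\
  exists s : seq 'M[F]_2, forall g, SL2_stabilizer A g -> g \in s.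

Definition jordan_block M : Prop :=
  exists l : F, M = l%:M + delta_mx 0 1.

Definition jordan_canonical M : Prop := is_diag_mx M \/ jordan_block M.

Definition stable_canonical A : Prop :=
  [/\ stable A, jordan_canonical (term A 1) & term A 2 0 1 = 1].

Definition triangular_canonical A : Prop :=
  [/\ triangularizable A, upper_triangular_seq A,
      is_diag_mx (term A 1) & term A 2 0 1 = 1].

Definition sigma A (j k : nat) : F :=
  \det (term A j *m term A k - term A k *m term A j).

Definition Delta A (j k l : nat) : F :=
  (\tr (term A j *m term A k *m term A l
        - term A l *m term A k *m term A j)) ^+ 2.

Definition delta A (j : nat) : F :=
  (\tr (term A j)) ^+ 2 - 4%:R * \det (term A j).

Definition case_1a A : Prop :=
  [/\ sigma A 1 2 != 0, delta A 1 != 0,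
      is_diag_mx (term A 1) & term A 2 0 1 = 1].

Definition case_1b A : Prop :=
  [/\ sigma A 1 2 != 0, delta A 1 = 0 /\ delta A 2 = 0,
      jordan_block (term A 1) & term A 2 0 1 = 1].

Definition case_1c A : Prop :=
  [/\ length_ge N 3,
      [/\ sigma A 1 2 = 0, sigma A 1 3 = 0 & sigma A 2 3 = 0],
      Delta A 1 2 3 != 0,
      is_diag_mx (term A 1) & term A 2 0 1 = 1].

Definition case_2a A : Prop :=
  [/\ forall i, diagonalizable (A i),
      is_diag_mx (term A 1) & term A 2 0 1 = 1].

(* The sequence has at least one non-diagonalizable term, and it has been
   rearranged so that such a term comes second; later terms may be
   non-diagonalizable as well. *)
Definition case_2b A : Prop :=
  [/\ ~ diagonalizable (term A 2),
      is_diag_mx (term A 1) & jordan_block (term A 2)].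

End MatrixSequences.

(* Main.v *)
Require Import Defs.
From HB Require Import structures.
From mathcomp Require Import all_boot all_order all_algebra.
From mathcomp Require Import mpoly ring.
From Stdlib Require Import Classical.

(* If some commutator is nonsingular, its first matrix is put in Jordan form (with
   distinct eigenvalues if one of the two discriminants is nonzero) and a shear or
   a diagonal rescaling makes b_2 = 1. If all commutators are singular but the
   sequence is not triangularizable, a diagonal A_1 has one strictly upper and
   one strictly lower triangular partner modulo diagonal matrices. In either case
   the matrix units E_12 and E_21 are noncommutative polynomials in the terms,
   and this makes the sequence stable: the stabilizer is {1, -1}, and a sequence
   satisfying all the polynomial identities of the orbit carries its own system of
   matrix units, which is conjugate to the standard one. *)

Set Implicit Arguments.
Unset Strict Implicit.
Unset Printing Implicit Defensive.

Import GRing.Theory.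
Local Open Scope ring_scope.

(* The columns of [g] are the [e k 0 u] for a basis vector [u] with [e 0 0 u]
   nonzero. *)
Lemma matrix_units_conj (F : fieldType) (n : nat)
    (e : 'I_n.+1 -> 'I_n.+1 -> 'M[F]_n.+1) :
    (forall i j k l, e i j *m e k l = e i l *+ (j == k)) ->
    \sum_i e i i = 1%:M ->
  exists2 g, g \in unitmx & forall i j, e i j *m g = g *m delta_mx i j.
Proof.
move=> eM e1.
(* If [e 0 0] vanished, so would every [e i i = e i 0 *m e 0 0 *m e 0 i], against [e1]. *)
have [p [q e00N0]] : exists p q, e 0 0 p q != 0.
  apply: NNPP => none; have e00 : e 0 0 = 0.
    apply/matrixP=> p q; rewrite mxE; apply/eqP; apply/negPn/negP=> pq.
    by apply: none; exists p, q.
  have /matrixP/(_ 0 0) := e1; rewrite big1 => [|i _].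
    by rewrite !mxE eqxx => /esym/eqP; rewrite oner_eq0.
  have := eM i 0 0 i; rewrite eqxx mulr1n => <-.
  have := eM 0 0 0 i; rewrite eqxx mulr1n => <-.
  by rewrite e00 mul0mx mulmx0.
pose g := \matrix_(r, k) e k 0 r q.
(* A left inverse of [g] up to a nonzero scalar: [e 0 k *m e l 0] is [e 0 0] if [k = l] and 0
   otherwise. *)
pose h := \matrix_(k, s) e 0 k p s.
have hg : h *m g = (e 0 0 p q)%:M.
  apply/matrixP=> k l; rewrite !mxE.
  have /matrixP/(_ p q) := eM 0 k l 0; rewrite mulmxnE mxE => <-.
  by apply: eq_bigr => s _; rewrite !mxE.
exists g.
  have: \det h * \det g != 0.
    by rewrite -det_mulmx hg det_scalar expf_neq0.
  by rewrite mulf_eq0 negb_or unitmxE unitfE => /andP[].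
move=> i j; apply/matrixP=> r k; rewrite !mxE [RHS](bigD1 i) //= [X in _ + X]big1 ?addr0.
  rewrite !mxE eqxx /= mulr_natr eq_sym -mulmxnE -eM mxE.
  by apply: eq_bigr => s _; rewrite !mxE.
by move=> s /negbTE si; rewrite !mxE si mulr0.
Qed.

(** * Indices of size two and quadratic equations *)

Variant ord2_spec : 'I_2 -> Type := Ord2_0 : ord2_spec 0 | Ord2_1 : ord2_spec 1.

Lemma ord2P (i : 'I_2) : ord2_spec i.
Proof.
case: i => [[|[|//]] lti].
  by rewrite (_ : Ordinal lti = 0); [exact: Ord2_0 | exact: val_inj].
by rewrite (_ : Ordinal lti = 1); [exact: Ord2_1 | exact: val_inj].
Qed.

Lemma sum_ord2 (V : nmodType) (f : 'I_2 -> V) : \sum_i f i = f 0 + f 1.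
Proof. by rewrite !big_ord_recl big_ord0 addr0; congr (_ + f _); apply: val_inj. Qed.

Lemma mulmx2E (R : pzRingType) (M M' : 'M[R]_2) r s :
  (M *m M') r s = M r 0 * M' 0 s + M r 1 * M' 1 s.
Proof. by rewrite mxE sum_ord2. Qed.

Lemma quadratic_root (F : closedFieldType) (a b c : F) :
  a != 0 -> exists x, a * x ^+ 2 + b * x + c = 0.
Proof.
move=> aN0.
have [x xE] := solve_monicpoly (fun i => [:: - (c / a); - (b / a)]`_i) (isT : 0 < 2)%N.
exists x; by rewrite xE sum_ord2 /=; field.
Qed.

(** * Stability *)

Section Stability.
Variables (F : closedFieldType) (N : option nat).
Implicit Types (f : mxseq F N -> F) (A B C : mxseq F N) (M : 'M[F]_2).
Implicit Types (P Q : mxseq F N -> 'M[F]_2).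

(** * Polynomial functions and equivariant matrix polynomials *)

Lemma polynomial_function_const (c : F) :
  polynomial_function (fun _ : mxseq F N => c).
Proof.
exists 0%N, c%:MP, (fun m : 'I_0 => match notF (ltn_ord m) with end) => A.
by rewrite mevalC.
Qed.

Lemma polynomial_function_entry (i : position N) (r s : 'I_2) :
  polynomial_function (fun A => A i r s).
Proof.
by exists 1%N, 'X_0, (fun=> (i, r, s)) => A; rewrite mevalXU.
Qed.

(* Both operands are rewritten over the disjoint union of their variables. *)
Lemma polynomial_function_common f1 f2 :
    polynomial_function f1 -> polynomial_function f2 ->
  exists k (p1 p2 : {mpoly F[k]}) (x : 'I_k -> position N * 'I_2 * 'I_2),
    (forall A, f1 A = p1.@[fun m => A (x m).1.1 (x m).1.2 (x m).2]) /\
    (forall A, f2 A = p2.@[fun m => A (x m).1.1 (x m).1.2 (x m).2]).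
Proof.
move=> [k1 [p1 [x1 f1E]]] [k2 [p2 [x2 f2E]]]; exists (k1 + k2)%N.
exists (p1 \mPo [tuple 'X_(lshift k2 i) | i < k1]).
exists (p2 \mPo [tuple 'X_(rshift k1 i) | i < k2]).
exists (fun m => match split m with inl i => x1 i | inr i => x2 i end).
split=> A; rewrite ?f1E ?f2E comp_mpoly_meval; apply: meval_eq => m.
  by rewrite tnth_mktuple mevalXU (unsplitK (inl m)).
by rewrite tnth_mktuple mevalXU (unsplitK (inr m)).
Qed.

Lemma polynomial_functionD f1 f2 :
    polynomial_function f1 -> polynomial_function f2 ->
  polynomial_function (fun A => f1 A + f2 A).
Proof.
move=> Pf1 Pf2.
have [k [p1 [p2 [x [E1 E2]]]]] := polynomial_function_common Pf1 Pf2.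
by exists k, (p1 + p2), x => A; rewrite mevalD E1 E2.
Qed.

Lemma polynomial_functionM f1 f2 :
    polynomial_function f1 -> polynomial_function f2 ->
  polynomial_function (fun A => f1 A * f2 A).
Proof.
move=> Pf1 Pf2.
have [k [p1 [p2 [x [E1 E2]]]]] := polynomial_function_common Pf1 Pf2.
by exists k, (p1 * p2), x => A; rewrite mevalM E1 E2.
Qed.

(** Sequences are functions compared pointwise by [=1]; a polynomial function reads only their
    entries. *)
Lemma polynomial_function_ext f A B :
  polynomial_function f -> A =1 B -> f A = f B.
Proof.
by move=> [k [p [x fE]]] AB; rewrite !fE; apply: meval_eq => m; rewrite AB.
Qed.

(** Noncommutative polynomials in the terms are the intended examples; only these two properties
    enter the stability argument. *)
Definition equivariant_polynomial P : Prop :=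
  (forall r s, polynomial_function (fun A => P A r s)) /\
  (forall g A, g \in unitmx -> P (conj_seq g A) = g *m P A *m invmx g).

Lemma equivariant_term (i : position N) :
  equivariant_polynomial (fun A => A i).
Proof. by split=> // r s; apply: polynomial_function_entry. Qed.

Lemma equivariant_scalar (c : F) : equivariant_polynomial (fun=> c%:M).
Proof.
split=> [r s|g A gU]; first exact: polynomial_function_const.
by rewrite mul_mx_scalar -scalemxAl mulmxV // scalemx1.
Qed.

Lemma equivariantD P Q : equivariant_polynomial P -> equivariant_polynomial Q ->
  equivariant_polynomial (fun A => P A + Q A).
Proof.
move=> [pP eP] [pQ eQ]; split=> [r s|g A gU].
  have [k [p [x E]]] := polynomial_functionD (pP r s) (pQ r s).
  by exists k, p, x => A; rewrite mxE E.
by rewrite eP // eQ // mulmxDr mulmxDl.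
Qed.

Lemma equivariantM P Q : equivariant_polynomial P -> equivariant_polynomial Q ->
  equivariant_polynomial (fun A => P A *m Q A).
Proof.
move=> [pP eP] [pQ eQ]; split=> [r s|g A gU].
  have [k [p [x E]]] := polynomial_functionD
    (polynomial_functionM (pP r 0) (pQ 0 s))
    (polynomial_functionM (pP r 1) (pQ 1 s)).
  by exists k, p, x => A; rewrite mulmx2E E.
by rewrite eP // eQ // !mulmxA mulmxKV.
Qed.

Lemma equivariantZ (c : F) P : equivariant_polynomial P ->
  equivariant_polynomial (fun A => c *: P A).
Proof.
move=> eP; have [pP qP] := equivariantM (equivariant_scalar c) eP.
split=> [r s|g A gU]; last by have := qP g A gU; rewrite !mul_scalar_mx.
by have [k [p [x E]]] := pP r s; exists k, p, x => A; rewrite -E mul_scalar_mx.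
Qed.

Lemma equivariant_ext P A B : equivariant_polynomial P -> A =1 B -> P A = P B.
Proof.
move=> [pP _] AB; apply/matrixP=> r s.
by rewrite (polynomial_function_ext (pP r s) AB).
Qed.

(** A substitute for membership in the algebra generated by the terms of [B]; the closure lemmas
    below supply the algebra operations. *)
Definition generated B M : Prop :=
  exists2 P, equivariant_polynomial P & P B = M.

Lemma generated_term B i : generated B (B i).
Proof. by exists (fun A => A i) => //; apply: equivariant_term. Qed.

Lemma generated_scalar B (c : F) : generated B c%:M.
Proof. by exists (fun=> c%:M) => //; apply: equivariant_scalar. Qed.

Lemma generatedD B M1 M2 : generated B M1 -> generated B M2 ->
  generated B (M1 + M2).
Proof. by move=> [P eP <-] [Q eQ <-]; eexists; first exact: equivariantD eP eQ. Qed.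

Lemma generatedM B M1 M2 : generated B M1 -> generated B M2 ->
  generated B (M1 *m M2).
Proof. by move=> [P eP <-] [Q eQ <-]; eexists; first exact: equivariantM eP eQ. Qed.

Lemma generatedZ B (c : F) M : generated B M -> generated B (c *: M).
Proof. by move=> [P eP <-]; exists (fun A => c *: P A) => //; apply: equivariantZ. Qed.

(* The closed set cutting out the orbit of [B] is the zero set of all the
   polynomial functions that vanish on it: a point [C] of it satisfies every
   relation [P B = 0] with [P] equivariant. Applied to the relations between the
   matrix units generated by [B] and the terms of [B], this yields a system of
   matrix units in which [C] has the same coordinates as [B]. *)
Lemma orbit_closed B : (forall r s, generated B (delta_mx r s)) ->
  zariski_closed (SL2_orbit B).
Proof.
move=> genB.
exists (fun f => polynomial_function f /\ forall A, SL2_orbit B A -> f A = 0).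
  by move=> f [].
move=> C; split=> [BC f [_ f0]|C0]; first exact: f0.
have rel P Q : equivariant_polynomial P -> equivariant_polynomial Q ->
    P B = Q B -> P C = Q C.
  move=> eP eQ PQ; have eD := equivariantD eP (equivariantZ (-1) eQ).
  have D0 : P C + -1 *: Q C = 0.
    apply/matrixP=> r s; rewrite [RHS]mxE.
    apply: (C0 (fun A => (P A + -1 *: Q A) r s)); split; first exact: eD.1.
    move=> A [g g1 gA].
    rewrite -(polynomial_function_ext (eD.1 r s) gA) eD.2.
      by rewrite PQ scaleN1r subrr mulmx0 mul0mx mxE.
    by rewrite unitmxE g1 unitr1.
  by apply/eqP; rewrite -subr_eq0 -scaleN1r D0.
have [E EP] : exists E : 'I_2 -> 'I_2 -> mxseq F N -> 'M[F]_2, forall r s,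
    equivariant_polynomial (E r s) /\ E r s B = delta_mx r s.
  have [E00 ? B00] := genB 0 0; have [E01 ? B01] := genB 0 1.
  have [E10 ? B10] := genB 1 0; have [E11 ? B11] := genB 1 1.
  exists (fun r s => if r == 0 then if s == 0 then E00 else E01
                     else if s == 0 then E10 else E11).
  by move=> r s; case: (ord2P r); case: (ord2P s).
have eE r s : equivariant_polynomial (E r s) := (EP r s).1.
have EB r s : E r s B = delta_mx r s := (EP r s).2.
have EM i j k l : E i j C *m E k l C = E i l C *+ (j == k).
  rewrite -scaler_nat.
  apply: (rel _ _ (equivariantM (eE i j) (eE k l)) (equivariantZ _ (eE i l))).
  by rewrite !EB mul_delta_mx_cond scaler_nat.
have E1 : \sum_i E i i C = 1%:M.
  rewrite sum_ord2.
  apply: (rel _ _ (equivariantD (eE _ _) (eE _ _)) (equivariant_scalar 1)).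
  rewrite !EB; apply/matrixP=> r s; case: (ord2P r); case: (ord2P s);
  by rewrite !mxE /= ?addr0 ?add0r.
have [g gU gE] := matrix_units_conj EM E1.
(* Conjugation by [g] ignores scaling, and algebraic closedness provides a square root of
   [1 / \det g]. *)
have [x xg] : exists x : F, \det (x *: g) = 1.
  have dN0 : \det g != 0 by rewrite -unitfE -unitmxE.
  have [x x0] := quadratic_root 0 (- 1) dN0; exists x.
  by apply/eqP; rewrite detZ -subr_eq0 -[X in _ == X]x0; apply/eqP; ring.
exists (x *: g) => // i.
have xgU : x *: g \in unitmx by rewrite unitmxE xg unitr1.
have CE : C i = (B i 0 0 *: E 0 0 C + B i 0 1 *: E 0 1 C) +
                (B i 1 0 *: E 1 0 C + B i 1 1 *: E 1 1 C).
  apply: (rel _ _ (equivariant_term i)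
    (equivariantD (equivariantD (equivariantZ _ (eE _ _)) (equivariantZ _ (eE _ _)))
                  (equivariantD (equivariantZ _ (eE _ _)) (equivariantZ _ (eE _ _))))).
  by rewrite !EB {1}[B i]matrix_sum_delta !sum_ord2.
have Cg : C i *m (x *: g) = (x *: g) *m B i.
  rewrite -scalemxAr -scalemxAl CE [B i in RHS]matrix_sum_delta !sum_ord2.
  by rewrite !(mulmxDl, mulmxDr) -!(scalemxAl, scalemxAr) !gE.
by rewrite /conj_seq -Cg mulmxK.
Qed.

(** An element fixing [B] commutes with every equivariant value at [B], hence with all matrix units,
    so it is scalar; determinant 1 leaves [1] and [-1]. *)
Lemma stabilizer_finite B : (forall r s, generated B (delta_mx r s)) ->
  exists s : seq 'M[F]_2, forall g, SL2_stabilizer B g -> g \in s.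
Proof.
move=> genB; exists [:: 1%:M; - 1%:M] => g [g1 gB].
have gU : g \in unitmx by rewrite unitmxE g1 unitr1.
have gC r s : g *m delta_mx r s = delta_mx r s *m g.
  have [P eP <-] := genB r s.
  by rewrite -[in RHS](equivariant_ext eP gB) eP.2 // mulmxKV.
have gE r s k l : g k r *+ (s == l) = g s l *+ (k == r).
  have /matrixP/(_ k l) := gC r s.
  rewrite !mulmx2E !mxE.
  case: (ord2P k); case: (ord2P l); case: (ord2P r); case: (ord2P s);
  by rewrite /= ?(mulr0, mulr1, mul0r, mul1r, addr0, add0r, mulr1n, mulr0n).
have gS : g = (g 0 0)%:M.
  apply/matrixP=> r s; rewrite !mxE.
  have := gE 1 0 1 0; have := gE 1 0 0 0; have := gE 0 0 1 0.
  by case: (ord2P r); case: (ord2P s); rewrite /= ?mulr1n ?mulr0n // => ? ?.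
have : (g 0 0 - 1) * (g 0 0 + 1) == 0.
  by rewrite -subr_sqr expr1n subr_eq0 -g1 {2}gS det_scalar.
rewrite mulf_eq0 subr_eq0 addr_eq0 !inE => /orP[] /eqP g00.
  by rewrite gS g00 eqxx.
by rewrite gS g00 raddfN eqxx orbT.
Qed.

(** The two products of the off-diagonal units are the diagonal units. *)
Lemma stable_of_units B :
  generated B (delta_mx 0 1) -> generated B (delta_mx 1 0) -> stable B.
Proof.
move=> gen01 gen10.
have genB r s : generated B (delta_mx r s).
  case: (ord2P r); case: (ord2P s) => //.
    by rewrite -(mul_delta_mx (1 : 'I_2)); apply: generatedM.
  by rewrite -(mul_delta_mx (0 : 'I_2)); apply: generatedM.
by split; [apply: orbit_closed | apply: stabilizer_finite].
Qed.

End Stability.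

(** * Normal forms under simultaneous conjugation *)

Section Matrices2.
Variable R : comNzRingType.
Implicit Types (a b c d : R) (M : 'M[R]_2).

Definition mx2 a b c d : 'M[R]_2 :=
  \matrix_(r, s) if r == 0 then if s == 0 then a else b
                 else if s == 0 then c else d.

Lemma mx2E a b c d :
  (mx2 a b c d 0 0 = a) * (mx2 a b c d 0 1 = b) *
  (mx2 a b c d 1 0 = c) * (mx2 a b c d 1 1 = d).
Proof. by rewrite !mxE. Qed.

Lemma eq_mx2 M M' : M 0 0 = M' 0 0 -> M 0 1 = M' 0 1 ->
  M 1 0 = M' 1 0 -> M 1 1 = M' 1 1 -> M = M'.
Proof.
by move=> E00 E01 E10 E11; apply/matrixP=> r s; case: (ord2P r); case: (ord2P s).
Qed.

Lemma det_mx22 M : \det M = M 0 0 * M 1 1 - M 0 1 * M 1 0.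
Proof.
rewrite (expand_det_row _ 0) sum_ord2 /cofactor !det_mx11 !mxE /= mul1r mulN1r mulrN.
by congr (_ * M _ _ - _ * M _ _); apply: val_inj.
Qed.

Lemma mxtrace22 M : \tr M = M 0 0 + M 1 1.
Proof. exact: sum_ord2. Qed.

Lemma diag_mx22P M : reflect (M 0 1 = 0 /\ M 1 0 = 0) (is_diag_mx M).
Proof.
apply: (iffP is_diag_mxP) => [dM|[E01 E10] r s]; first by split; apply: dM.
by case: (ord2P r); case: (ord2P s).
Qed.

Lemma upper_triangular22P (F : closedFieldType) (M : 'M[F]_2) :
  reflect (M 1 0 = 0) (upper_triangular M).
Proof.
apply: (iffP is_trig_mxP) => [tM|E10 r s]; first by have := tM 0 1 isT; rewrite mxE.
by case: (ord2P r); case: (ord2P s); rewrite mxE.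
Qed.

(** [comm_det] and [disc] restate [sigma] and [delta] for bare matrices, so that they apply before
    the chosen terms are moved to positions 1 and 2. *)
Definition comm_det M M' := \det (M *m M' - M' *m M).

Definition disc M := \tr M ^+ 2 - 4%:R * \det M.

Lemma disc22E M : disc M = (M 0 0 - M 1 1) ^+ 2 + 4%:R * M 0 1 * M 1 0.
Proof. rewrite /disc mxtrace22 det_mx22; ring. Qed.

Lemma comm_det_diag M M' : M 0 1 = 0 -> M 1 0 = 0 ->
  comm_det M M' = (M 0 0 - M 1 1) ^+ 2 * (M' 0 1 * M' 1 0).
Proof.
move=> E01 E10; rewrite /comm_det det_mx22 !mxE !sum_ord2 E01 E10; ring.
Qed.

Lemma comm_det_jordan M M' : M 0 0 = M 1 1 -> M 1 0 = 0 ->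
  comm_det M M' = - (M 0 1 * M' 1 0) ^+ 2.
Proof.
move=> E00 E10; rewrite /comm_det det_mx22 !mxE !sum_ord2 E00 E10; ring.
Qed.

End Matrices2.

(** * Similarity and its invariants *)

Section NormalForms.
Variables (F : closedFieldType) (N : option nat).
Implicit Types (A B C : mxseq F N) (M : 'M[F]_2) (i j k : position N).

(** An explicit two-sided inverse [h] in place of [invmx g] reduces later conjugations to entrywise
    computations. *)
Lemma similar_seqP A B : similar_seq A B <->
  exists g h : 'M[F]_2, [/\ g *m h = 1%:M, h *m g = 1%:M & forall i, B i = g *m A i *m h].
Proof.
split=> [[g gU AB]|[g [h [gh hg BE]]]].
  by exists g, (invmx g); rewrite mulmxV // mulVmx //; split=> // i; rewrite -AB.
have [gU _] := mulmx1_unit gh; exists g => // i.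
by rewrite /conj_seq BE -[h]mul1mx -(mulVmx gU) -(mulmxA (invmx g)) gh mulmx1.
Qed.

Lemma similar_refl A : similar_seq A A.
Proof. by apply/similar_seqP; exists 1%:M, 1%:M; split=> *; rewrite ?mul1mx ?mulmx1. Qed.

Lemma similar_trans B A C : similar_seq A B -> similar_seq B C -> similar_seq A C.
Proof.
move=> /similar_seqP[g [h [gh hg BE]]] /similar_seqP[g' [h' [gh' hg' CE]]].
apply/similar_seqP; exists (g' *m g), (h *m h'); split=> [||i].
- by rewrite -mulmxA (mulmxA g) gh mul1mx.
- by rewrite -mulmxA (mulmxA h') hg' mul1mx.
- by rewrite CE BE !mulmxA.
Qed.

Lemma similar_sym A B : similar_seq A B -> similar_seq B A.
Proof.
move=> /similar_seqP[g [h [gh hg BE]]]; apply/similar_seqP; exists h, g.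
by split=> // i; rewrite BE !mulmxA hg mul1mx -mulmxA hg mulmx1.
Qed.

Lemma similar_rearrange A B (s : position N -> position N) :
  similar_seq A B -> similar_seq (A \o s) (B \o s).
Proof. by move=> [g gU AB]; exists g => // i; apply: AB. Qed.

Lemma similar_comm A B i j :
  similar_seq A B -> comm_mx (A i) (A j) -> comm_mx (B i) (B j).
Proof.
move=> /similar_seqP[g [h [gh hg BE]]] AC; rewrite /comm_mx !BE.
by rewrite !mulmxA -(mulmxA _ h g) -(mulmxA (g *m A j) h g) hg !mulmx1
  -!(mulmxA g) AC.
Qed.

Lemma similar_disc A B i : similar_seq A B -> disc (B i) = disc (A i).
Proof.
move=> /similar_seqP[g [h [gh hg BE]]].
rewrite /disc BE mxtrace_mulC mulmxA hg mul1mx !det_mulmx mulrAC -det_mulmx.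
by rewrite gh det1 mul1r.
Qed.

Lemma similar_comm_det A B i j :
  similar_seq A B -> comm_det (B i) (B j) = comm_det (A i) (A j).
Proof.
move=> /similar_seqP[g [h [gh hg BE]]]; rewrite /comm_det !BE.
rewrite !mulmxA -(mulmxA _ h g) -(mulmxA (g *m A j) h g) hg !mulmx1.
rewrite -mulmxBl -!(mulmxA g) -mulmxBr !det_mulmx mulrAC -det_mulmx gh det1.
by rewrite mul1r.
Qed.

Lemma diagonalizable2P M : diagonalizable M <->
  exists g h : 'M[F]_2, g *m h = 1%:M /\ is_diag_mx (g *m M *m h).
Proof.
split=> [[g gU]|[g [h [gh dM]]]].
  by rewrite /similar_to conjumx // => dM; exists g, (invmx g); rewrite mulmxV.
have [gU hU] := mulmx1_unit gh; exists g => //=.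
by rewrite /similar_to conjumx // -[invmx g]mulmx1 -gh mulKmx.
Qed.

Lemma similar_diagonalizable A B i :
  similar_seq A B -> diagonalizable (A i) -> diagonalizable (B i).
Proof.
move=> /similar_sym/similar_seqP[g [h [gh hg AE]]] /diagonalizable2P[p [q [pq dA]]].
apply/diagonalizable2P; exists (p *m g), (h *m q); split.
  by rewrite mulmxA -(mulmxA p) gh mulmx1.
by move: dA; rewrite AE !mulmxA.
Qed.

(** Conjugation by the unipotent matrix with upper right entry [t], written out in entries. Likewise
    [rescale] is conjugation by the diagonal matrix with entries [u^-1] and 1, and [swap] by the
    transposition matrix. *)
Definition shear (t : F) A : mxseq F N := fun i =>
  mx2 (A i 0 0 + t * A i 1 0)
      (A i 0 1 + t * (A i 1 1 - A i 0 0) - t ^+ 2 * A i 1 0)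
      (A i 1 0) (A i 1 1 - t * A i 1 0).

Definition rescale (u : F) A : mxseq F N := fun i =>
  mx2 (A i 0 0) (u^-1 * A i 0 1) (u * A i 1 0) (A i 1 1).

Definition swap A : mxseq F N := fun i =>
  mx2 (A i 1 1) (A i 1 0) (A i 0 1) (A i 0 0).

Lemma similar_shear t A : similar_seq A (shear t A).
Proof.
apply/similar_seqP; exists (mx2 1 t 0 1), (mx2 1 (- t) 0 1).
split=> [||i]; apply: eq_mx2; rewrite !mulmx2E ?mxE //=; ring.
Qed.

Lemma similar_rescale u A : u != 0 -> similar_seq A (rescale u A).
Proof.
move=> u0; apply/similar_seqP; exists (mx2 u^-1 0 0 1), (mx2 u 0 0 1).
by split=> [||i]; apply: eq_mx2; rewrite !mulmx2E ?mxE //=; field.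
Qed.

Lemma similar_swap A : similar_seq A (swap A).
Proof.
apply/similar_seqP; exists (mx2 0 1 1 0), (mx2 0 1 1 0).
split=> [||i]; apply: eq_mx2; rewrite !mulmx2E ?mxE //=; ring.
Qed.

(** * Normal forms of single terms and of pairs *)

Lemma diagonalizable_triangular M :
  M 1 0 = 0 -> M 0 0 != M 1 1 -> diagonalizable M.
Proof.
move=> E10 ne; have ne' : M 0 0 - M 1 1 != 0 by rewrite subr_eq0.
(* The shear by [t] adds [t * (M 1 1 - M 0 0)] to the upper right entry; this [t] cancels it. *)
pose t := M 0 1 / (M 0 0 - M 1 1).
apply/diagonalizable2P; exists (mx2 1 t 0 1), (mx2 1 (- t) 0 1); split.
  apply: eq_mx2; rewrite !mulmx2E ?mxE //=; ring.
apply/diag_mx22P; rewrite !mulmx2E !mx2E E10 /t; split; last by ring.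
by field.
Qed.

Lemma upper_term A i : exists2 B, similar_seq A B & B i 1 0 = 0.
Proof.
have [E10|E10] := eqVneq (A i 1 0) 0; first by exists A => //; apply: similar_refl.
have nE10 : - A i 1 0 != 0 by rewrite oppr_eq0.
(* The root makes the upper right entry of the sheared term vanish; [swap] moves that zero below the
   diagonal. *)
have [t tE] := quadratic_root (A i 1 1 - A i 0 0) (A i 0 1) nE10.
exists (swap (shear t A)).
  exact: similar_trans (similar_shear _ _) (similar_swap _).
rewrite !mx2E -[RHS]tE; ring.
Qed.

(** With distinct diagonal entries a shear clears the upper right entry; with equal ones a rescaling
    turns it into 1 unless it is 0 already. *)
Lemma normal_term A i : exists2 B, similar_seq A B & B i 1 0 = 0 /\
  (B i 0 1 = 0 \/ (B i 0 1 = 1 /\ B i 0 0 = B i 1 1)).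
Proof.
have [B AB E10] := upper_term A i.
have [Ed|Ed] := eqVneq (B i 0 0) (B i 1 1); last first.
  exists (shear (B i 0 1 / (B i 0 0 - B i 1 1)) B).
    exact: similar_trans AB (similar_shear _ _).
  rewrite !mx2E E10; split=> //; left; field.
  by rewrite subr_eq0.
have [E01|E01] := eqVneq (B i 0 1) 0; first by exists B => //; split=> //; left.
exists (rescale (B i 0 1) B); first exact: similar_trans AB (similar_rescale _ E01).
by rewrite !mx2E E10 mulr0 mulVf //; split=> //; right.
Qed.

(** Shears and rescalings of a triangular sequence keep the diagonals; recording this preserves a
    double eigenvalue of [A j], as case 2.b requires. *)
Lemma normal_pair_triangular A i j :
    (forall k, A k 1 0 = 0) -> A i 0 0 != A i 1 1 -> ~ comm_mx (A i) (A j) ->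
  exists2 B, similar_seq A B & [/\ forall k, B k 1 0 = 0, B i 0 1 = 0, B j 0 1 = 1 &
    forall k, B k 0 0 = A k 0 0 /\ B k 1 1 = A k 1 1].
Proof.
move=> tA ne nc; have ne' : A i 0 0 - A i 1 1 != 0 by rewrite subr_eq0.
pose B := shear (A i 0 1 / (A i 0 0 - A i 1 1)) A.
have AB : similar_seq A B by apply: similar_shear.
have tB k : B k 1 0 = 0 by rewrite !mx2E.
have Bi : B i 0 1 = 0 by rewrite !mx2E tA; field.
(* Otherwise both terms would be diagonal and would commute. *)
have Bj : B j 0 1 != 0.
  apply/eqP=> Bj; apply: nc; apply: (similar_comm (similar_sym AB)).
  by apply: eq_mx2; rewrite !mulmx2E ?tB ?Bi ?Bj; ring.
exists (rescale (B j 0 1) B); first exact: similar_trans AB (similar_rescale _ Bj).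
split=> [k|||k].
- by rewrite mx2E tB mulr0.
- by rewrite mx2E Bi mulr0.
- by rewrite mx2E mulVf.
- by rewrite !mx2E tA mulr0 addr0 subr0.
Qed.

(** Distinct eigenvalues make both diagonal units polynomials in [B i]; compressing [B j] and [B k]
    between these units isolates the off-diagonal ones. *)
Lemma stable_diag_pair B i j k : is_diag_mx (B i) -> B i 0 0 != B i 1 1 ->
  B j 0 1 != 0 -> B k 1 0 != 0 -> stable B.
Proof.
move=> /diag_mx22P[E01 E10] ne E01j E10k.
have ne' : B i 0 0 - B i 1 1 != 0 by rewrite subr_eq0.
have gen00 : generated B (delta_mx 0 0).
  have -> : (delta_mx 0 0 : 'M[F]_2) = (B i 0 0 - B i 1 1)^-1 *: (B i + (- B i 1 1)%:M).
    by apply: eq_mx2; rewrite !mxE /= ?E01 ?E10; field.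
  exact: generatedZ (generatedD (generated_term _ _) (generated_scalar _ _)).
have gen11 : generated B (delta_mx 1 1).
  have -> : delta_mx 1 1 = 1%:M + (- 1) *: delta_mx 0 0 :> 'M[F]_2.
    by apply: eq_mx2; rewrite !mxE /=; ring.
  exact: generatedD (generated_scalar _ _) (generatedZ _ gen00).
apply: stable_of_units.
  have -> : (delta_mx 0 1 : 'M[F]_2) = (B j 0 1)^-1 *: (delta_mx 0 0 *m B j *m delta_mx 1 1).
    by apply: eq_mx2; rewrite mxE [RHS]mxE !mulmx2E !mxE /=; field.
  exact: generatedZ (generatedM (generatedM gen00 (generated_term _ _)) gen11).
have -> : (delta_mx 1 0 : 'M[F]_2) = (B k 1 0)^-1 *: (delta_mx 1 1 *m B k *m delta_mx 0 0).
  by apply: eq_mx2; rewrite mxE [RHS]mxE !mulmx2E !mxE /=; field.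
exact: generatedZ (generatedM (generatedM gen11 (generated_term _ _)) gen00).
Qed.

(** The nilpotent part of the block is the upper unit; its product with [B j - (B j 1 1)%:M] is
    [B j 1 0] times the first diagonal unit. *)
Lemma stable_jordan_pair B i j : jordan_block (B i) -> B j 1 0 != 0 -> stable B.
Proof.
move=> [l Bi] c0.
have gen01 : generated B (delta_mx 0 1).
  have -> : (delta_mx 0 1 : 'M[F]_2) = B i + (- l)%:M.
    by rewrite Bi addrAC -raddfD subrr raddf0 add0r.
  exact: generatedD (generated_term _ _) (generated_scalar _ _).
have gen00 : generated B (delta_mx 0 0).
  have -> : (delta_mx 0 0 : 'M[F]_2) =
      (B j 1 0)^-1 *: (delta_mx 0 1 *m (B j + (- B j 1 1)%:M)).
    by apply: eq_mx2; rewrite mxE [RHS]mxE !mulmx2E !mxE /=; field.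
  exact: generatedZ (generatedM gen01
    (generatedD (generated_term _ _) (generated_scalar _ _))).
have gen11 : generated B (delta_mx 1 1).
  have -> : delta_mx 1 1 = 1%:M + (- 1) *: delta_mx 0 0 :> 'M[F]_2.
    by apply: eq_mx2; rewrite !mxE /=; ring.
  exact: generatedD (generated_scalar _ _) (generatedZ _ gen00).
apply: stable_of_units gen01 _.
have -> : (delta_mx 1 0 : 'M[F]_2) = (B j 1 0)^-1 *: (delta_mx 1 1 *m B j *m delta_mx 0 0).
  by apply: eq_mx2; rewrite mxE [RHS]mxE !mulmx2E !mxE /=; field.
exact: generatedZ (generatedM (generatedM gen11 (generated_term _ _)) gen00).
Qed.

(** Once [A i] is normalized, [disc] is the squared difference of its diagonal entries, and
    [comm_det] is that square times both off-diagonal entries of the other term. *)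
Lemma normal_pair_1a A i j : comm_det (A i) (A j) != 0 -> disc (A i) != 0 ->
  exists2 B, similar_seq A B & [/\ is_diag_mx (B i), B i 0 0 != B i 1 1,
    B j 0 1 = 1 & B j 1 0 != 0].
Proof.
move=> sN0 dN0; have [B AB [E10 Bi]] := normal_term A i.
rewrite -(similar_comm_det _ _ AB) in sN0.
rewrite -(similar_disc _ AB) disc22E E10 mulr0 addr0 in dN0.
have ne : B i 0 0 != B i 1 1.
  by apply/eqP=> E; rewrite E subrr expr0n eqxx in dN0.
have E01 : B i 0 1 = 0 by case: Bi => // -[_ E]; rewrite E eqxx in ne.
rewrite comm_det_diag // !mulf_eq0 !negb_or in sN0.
have [_ /andP[bN0 cN0]] := andP sN0.
exists (rescale (B j 0 1) B); first exact: similar_trans AB (similar_rescale _ bN0).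
rewrite !mx2E mulVf // mulf_neq0 //; split=> //.
by apply/diag_mx22P; rewrite !mx2E E01 E10 !mulr0.
Qed.

Lemma jordan_block_entries M : M 0 0 = M 1 1 -> M 0 1 = 1 -> M 1 0 = 0 -> jordan_block M.
Proof.
move=> E00 E01 E10; exists (M 0 0).
by apply: eq_mx2; rewrite !mxE /= ?E00 ?E01 ?E10; ring.
Qed.

Lemma normal_pair_1b A i j : comm_det (A i) (A j) != 0 -> disc (A i) = 0 ->
  exists2 B, similar_seq A B & [/\ jordan_block (B i), B j 0 1 = 1 & B j 1 0 != 0].
Proof.
move=> sN0 d0; have [B AB [E10 Bi]] := normal_term A i.
rewrite -(similar_comm_det _ _ AB) in sN0.
have E00 : B i 0 0 = B i 1 1.
  apply/eqP; rewrite -subr_eq0 -sqrf_eq0.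
  by rewrite -(similar_disc _ AB) disc22E E10 mulr0 addr0 in d0; rewrite d0.
rewrite comm_det_jordan // oppr_eq0 sqrf_eq0 mulf_eq0 negb_or in sN0.
have [bN0 cN0] := andP sN0.
have E01 : B i 0 1 = 1 by case: Bi => [E|[]] //; rewrite E eqxx in bN0.
have ncN0 : - B j 1 0 != 0 by rewrite oppr_eq0.
(* A shear commutes with the Jordan block; the root [t] is the parameter for which it makes the
   upper right entry of [B j] equal to 1. *)
have [t tE] := quadratic_root (B j 1 1 - B j 0 0) (B j 0 1 - 1) ncN0.
exists (shear t B); first exact: similar_trans AB (similar_shear _ _).
rewrite !mx2E; split=> //.
  by apply: jordan_block_entries; rewrite !mx2E E10 ?E00 ?E01; ring.
apply/eqP; rewrite -subr_eq0 -[X in _ == X]tE; apply/eqP; ring.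
Qed.

End NormalForms.

(** * Choice of the first three terms *)

(** Moves the chosen terms to the front, also in an infinite sequence: a bijection for the tails is
    corrected by the transposition of [y] and [s x]. *)
Lemma bij_map_uniq (T : eqType) (p q : seq T) :
    uniq p -> uniq q -> size p = size q ->
  exists2 s : T -> T, bijective s & map s p = q.
Proof.
elim: p q => [|x p IH] [|y q] //=.
  by move=> *; exists id => //; exists id.
move=> /andP[xp up] /andP[yq uq] [/(IH _ up uq)[s bij_s sp]].
pose t z := if z == y then s x else if z == s x then y else z.
have tK : involutive t.
  move=> z; rewrite /t; have [->|zy] := eqVneq z y.
    by rewrite eqxx; case: eqVneq.
  have [->|zsx] := eqVneq z (s x); first by rewrite eqxx.
  by rewrite (negPf zy) (negPf zsx).
exists (t \o s); first exact: bij_comp (inv_bij tK) bij_s.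
rewrite /= {1}/t; congr (_ :: _).
  by case: eqVneq => // _; rewrite eqxx.
rewrite -sp; apply/eq_in_map=> z zp /=.
rewrite /t; case: eqVneq => [szy|_]; first by rewrite -szy -sp map_f in yq.
by case: eqVneq => // /(bij_inj bij_s) zx; rewrite -zx zp in xp.
Qed.

Section Assembly.
Variables (F : closedFieldType) (N : option nat).
Implicit Types (A B C : mxseq F N) (i j k : position N).

Lemma term_val A i : term A (val i) = A i.
Proof. by rewrite /term valK. Qed.

(** Used in case 1.c, where three distinct chosen terms guarantee that position 3 exists. *)
Lemma length_ge_uniq (t : seq (position N)) : uniq t -> length_ge N (size t).
Proof.
case: N t => [n|//] t ut /=; rewrite -[leqRHS](size_iota 1) -(size_map val).
apply: uniq_leq_size; first by rewrite (map_inj_uniq val_inj).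
by move=> _ /mapP[i _ ->]; rewrite mem_iota add1n ltnS; apply: valP i.
Qed.

Lemma triangular_normal_form A : (forall k, A k 1 0 = 0) -> ~ commutative_seq A ->
  exists B i j, [/\ i != j, similar_seq A B, forall k, B k 1 0 = 0,
    B i 0 1 = 0 & B j 0 1 = 1 /\
    ((forall k, diagonalizable (B k)) \/
     (~ diagonalizable (B j) /\ B j 0 0 = B j 1 1))].
Proof.
move=> tA ncA.
have [i [j [ne nc nd]]] : exists i j, [/\ A i 0 0 != A i 1 1, ~ comm_mx (A i) (A j) &
    (forall k, diagonalizable (A k)) \/
    (~ diagonalizable (A j) /\ A j 0 0 = A j 1 1)].
  (* Triangular matrices of size two with constant diagonals commute, so one member of a
     noncommuting pair has distinct diagonal entries. *)
  have [i0 [j0 [ne0 nc0]]] : exists i j, A i 0 0 != A i 1 1 /\ ~ comm_mx (A i) (A j).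
    apply: NNPP => none; apply: ncA => i j; apply: NNPP => nc.
    have [Ei|Ei] := eqVneq (A i 0 0) (A i 1 1); last by apply: none; exists i, j.
    have [Ej|Ej] := eqVneq (A j 0 0) (A j 1 1).
      by apply: nc; apply: eq_mx2; rewrite !mulmx2E ?tA ?Ei ?Ej; ring.
    by apply: none; exists j, i; split=> // cji; apply: nc; apply: comm_mx_sym.
  have [dA|] := classic (forall k, diagonalizable (A k)).
    by exists i0, j0; split=> //; left.
  move=> /not_all_ex_not[k ndk].
  have Ek : A k 0 0 = A k 1 1.
    by apply/eqP/negPn/negP=> nek; apply: ndk; apply: diagonalizable_triangular.
  exists i0, k; split=> //; last by right.
  have ne' : A i0 0 0 - A i0 1 1 != 0 by rewrite subr_eq0.
  (* The upper right entry of the commutator shows that commuting would force [A k 0 1 = 0], making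
     [A k] diagonal. *)
  move=> /matrixP/(_ 0 1); rewrite !mulmx2E Ek => /eqP.
  rewrite -subr_eq0 (_ : _ - _ = (A i0 0 0 - A i0 1 1) * A k 0 1); last by ring.
  rewrite mulf_eq0 (negPf ne') => /eqP bk.
  apply: ndk; apply/diagonalizable2P; exists 1%:M, 1%:M.
  rewrite !mul1mx mulmx1; split=> //; exact/diag_mx22P.
have [B AB [tB Bi Bj Bd]] := normal_pair_triangular tA ne nc.
exists B, i, j; split=> //.
  by apply/eqP=> ij; apply: nc; rewrite ij.
split=> //; case: nd => [dA|[ndA Ed]].
  by left=> k; apply: similar_diagonalizable AB (dA k).
right; split; last by have [-> ->] := Bd j.
by move=> dB; apply: ndA; apply: similar_diagonalizable (similar_sym AB) dB.
Qed.

(* If a term were a nonscalar matrix with a double eigenvalue, normalizing it to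
   a Jordan block would make every term upper triangular, as all [comm_det]
   vanish; hence of two noncommuting terms the first has distinct eigenvalues. *)
Lemma normal_triple_1c A : ~ commutative_seq A -> ~ triangularizable A ->
    (forall i j, comm_det (A i) (A j) = 0) ->
  exists B i j k, [/\ uniq [:: i; j; k], similar_seq A B,
    is_diag_mx (B i) /\ B i 0 0 != B i 1 1,
    B j 0 1 = 1 /\ B j 1 0 = 0 & B k 1 0 != 0 /\ B k 0 1 = 0].
Proof.
move=> ncA ntA s0.
have [i [j nc]] : exists i j, ~ comm_mx (A i) (A j).
  apply: NNPP => none; apply: ncA => i j; apply: NNPP => nc.
  by apply: none; exists i, j.
have [B AB [E10 Bi]] := normal_term A i.
have sB i1 j1 : comm_det (B i1) (B j1) = 0 by rewrite (similar_comm_det _ _ AB).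
have ntB C : similar_seq B C -> ~ (forall k, C k 1 0 = 0).
  move=> BC tC; apply: ntA; exists C; first exact: similar_trans AB BC.
  by move=> k; apply/upper_triangular22P.
have ncB : ~ comm_mx (B i) (B j).
  by move=> cB; apply: nc; apply: similar_comm (similar_sym AB) cB.
have [Ed|ne] := eqVneq (B i 0 0) (B i 1 1).
  case: Bi => [E01|[E01 _]].
    case: ncB; rewrite (_ : B i = (B i 0 0)%:M); first exact: comm_scalar_mx.
    by apply: eq_mx2; rewrite !mxE //= mulr1n.
  case: (ntB B (similar_refl _)) => k; apply/eqP.
  have /eqP := sB i k; rewrite comm_det_jordan // E01 mul1r oppr_eq0.
  by rewrite sqrf_eq0.
have E01 : B i 0 1 = 0 by case: Bi => // -[_ E]; rewrite E eqxx in ne.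
have ne' : B i 0 0 - B i 1 1 != 0 by rewrite subr_eq0.
have bc k : B k 0 1 = 0 \/ B k 1 0 = 0.
  have /eqP := sB i k; rewrite comm_det_diag // !mulf_eq0 (negPf ne') /=.
  by case/orP=> /eqP; [left|right].
(* As [B j] does not commute with the diagonal [B i], one of its off-diagonal entries is nonzero;
   [swap] puts it in the upper corner. *)
wlog bj : B AB E10 Bi sB ntB ncB ne E01 ne' bc / B j 0 1 != 0.
  move=> W; have [bj|] := eqVneq (B j 0 1) 0; last exact: W AB _ _ _ _ _ _ _ _ _.
  have BS := similar_swap B.
  apply: (W (swap B)); rewrite ?mx2E //.
  - exact: similar_trans AB BS.
  - by left.
  - by move=> i1 j1; rewrite (similar_comm_det _ _ BS).
  - by move=> C SC; apply: ntB; apply: similar_trans BS SC.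
  - by move=> cS; apply: ncB; apply: similar_comm (similar_sym BS) cS.
  - by rewrite eq_sym.
  - by rewrite -opprB oppr_eq0.
  - by move=> k; rewrite !mx2E; case: (bc k); [right|left].
  apply/eqP=> cj; apply: ncB; apply: eq_mx2;
  by rewrite !mulmx2E ?E10 ?E01 ?bj ?cj; ring.
have cj : B j 1 0 = 0 by case: (bc j) => // b0; rewrite b0 eqxx in bj.
have [k ck] : exists k, B k 1 0 != 0.
  apply: NNPP => none; apply: (ntB B (similar_refl _)) => k.
  by apply/eqP/negPn/negP=> ck; apply: none; exists k.
have bk : B k 0 1 = 0 by case: (bc k) => // c0; rewrite c0 eqxx in ck.
exists (rescale (B j 0 1) B), i, j, k; rewrite !mx2E; split.
- rewrite /= !inE !andbT negb_or -andbA; apply/and3P.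
  by split; apply/eqP=> E; [move: bj|move: ck|move: ck];
    rewrite -E ?E01 ?E10 ?cj eqxx.
- exact: similar_trans AB (similar_rescale _ bj).
- by split=> //; apply/diag_mx22P; rewrite !mx2E E01 E10 !mulr0.
- by rewrite mulVf // cj mulr0.
- by rewrite mulf_neq0 // bk mulr0.
Qed.

End Assembly.

(** * Assembly of the canonical forms *)

Theorem theorem4p3 (F : closedFieldType) (N : option nat)
    (N_ge2 : length_ge N 2) (A : mxseq F N)
    (ncA : ~ commutative_seq A) :
  exists A' B : mxseq F N,
    [/\ rearrangement A A', similar_seq A' B &
        (stable_canonical B /\ (case_1a B \/ case_1b B \/ case_1c B)) \/
        (triangular_canonical B /\ (case_2a B \/ case_2b B))].
Proof.
have N_ge1 : length_ge N 1 by case: N N_ge2 {A ncA} => // n /ltnW.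
pose p1 : position N := exist _ 1%N N_ge1.
pose p2 : position N := exist _ 2%N N_ge2.
have t1 (B : mxseq F N) : term B 1 = B p1 by exact: (term_val B p1).
have t2 (B : mxseq F N) : term B 2 = B p2 by exact: (term_val B p2).
have up : uniq [:: p1; p2] by [].
(* Conjugation acts termwise and so commutes with rearranging: the sequence is normalized first and
   rearranged afterwards. *)
suff [B [s [AB bij_s BP]]] : exists (B : mxseq F N) (s : position N -> position N),
    [/\ similar_seq A B, bijective s &
      (stable_canonical (B \o s) /\
        (case_1a (B \o s) \/ case_1b (B \o s) \/ case_1c (B \o s))) \/
      (triangular_canonical (B \o s) /\ (case_2a (B \o s) \/ case_2b (B \o s)))].
  exists (A \o s), (B \o s); split=> //; last exact: similar_rearrange.
  by exists s.
have [[i [j sN0]]|sN0] := classic (exists i j, comm_det (A i) (A j) != 0).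
  (* If only the second discriminant is nonzero, the pair is exchanged, which changes the commutator
     only by a sign. *)
  wlog [dN0|[di dj]] : i j sN0 / disc (A i) != 0 \/ disc (A i) = 0 /\ disc (A j) = 0.
  - move=> W; have [di|di] := eqVneq (disc (A i)) 0; last by apply: W sN0 _; left.
    have [dj|dj] := eqVneq (disc (A j)) 0; first by apply: W sN0 _; right.
    apply: (W j i); last by left.
    rewrite /comm_det -opprB -scaleN1r detZ mulf_neq0 // expf_neq0 //.
    by rewrite oppr_eq0 oner_eq0.
  - have [B AB [dB neB bj cj]] := normal_pair_1a sN0 dN0.
    have ij : uniq [:: i; j].
      rewrite /= inE andbT; apply/eqP=> ij; rewrite -ij in cj.
      by have /diag_mx22P[_ E] := dB; rewrite E eqxx in cj.
    have [s bij_s [s1 s2]] := bij_map_uniq up ij erefl.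
    exists B, s; split=> //; left; split.
      split; rewrite ?t1 ?t2 /= ?s1 ?s2 //; last by left.
      (* The second term supplies both nonzero off-diagonal entries. *)
      apply: (@stable_diag_pair _ _ _ p1 p2 p2); rewrite /= ?s1 ?s2 ?bj ?oner_eq0 //.
    left; split; rewrite ?/sigma ?/delta ?t1 ?t2 /= ?s1 ?s2 //.
      by rewrite -(similar_comm_det i j AB) in sN0.
    by rewrite -(similar_disc i AB) in dN0.
  have [B AB [dB bj cj]] := normal_pair_1b sN0 di.
  have ij : uniq [:: i; j].
    rewrite /= inE andbT; apply/eqP=> ij; rewrite -ij in cj.
    by have [l E] := dB; rewrite E !mxE /= addr0 eqxx in cj.
  have [s bij_s [s1 s2]] := bij_map_uniq up ij erefl.
  exists B, s; split=> //; left; split.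
    split; rewrite ?t1 ?t2 /= ?s1 ?s2 //; last by right.
    by apply: (@stable_jordan_pair _ _ _ p1 p2); rewrite /= ?s1 ?s2.
  right; left; split; rewrite ?/sigma ?/delta ?t1 ?t2 /= ?s1 ?s2 //.
    by rewrite -(similar_comm_det i j AB) in sN0.
  by split; [rewrite -[RHS]di|rewrite -[RHS]dj]; apply: similar_disc.
have s0 i j : comm_det (A i) (A j) = 0.
  by apply/eqP/negPn/negP=> sij; apply: sN0; exists i, j.
have [[C AC tC]|ntA] := classic (triangularizable A).
  have {}tC k : C k 1 0 = 0 by apply/upper_triangular22P/tC.
  have ncC : ~ commutative_seq C.
    move=> cC; apply: ncA => i j; exact: similar_comm (similar_sym AC) (cC i j).
  have [B [i [j [ij CB tB bi [bj dB]]]]] := triangular_normal_form tC ncC.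
  have AB := similar_trans AC CB.
  have uij : uniq [:: i; j] by rewrite /= inE ij.
  have [s bij_s [s1 s2]] := bij_map_uniq up uij erefl.
  have diB : is_diag_mx (B i) by apply/diag_mx22P.
  exists B, s; split=> //; right; split.
    have tBs : upper_triangular_seq (B \o s).
      by move=> k; apply/upper_triangular22P/tB.
    split; rewrite ?t1 ?t2 /= ?s1 ?s2 //.
    by exists (B \o s) => //; apply: similar_refl.
  case: dB => [dB|[ndB Ed]]; [left|right]; split; rewrite ?t1 ?t2 /= ?s1 ?s2 //.
  exact: jordan_block_entries Ed bj (tB j).
have [B [i [j [k [uijk AB [dB neB] [bj cj] [ck bk]]]]]] := normal_triple_1c ncA ntA s0.
have N_ge3 := length_ge_uniq uijk.
pose p3 : position N := exist _ 3%N N_ge3.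
have t3 (D : mxseq F N) : term D 3 = D p3 by exact: (term_val D p3).
have up3 : uniq [:: p1; p2; p3] by [].
have [s bij_s [s1 s2 s3]] := bij_map_uniq up3 uijk erefl.
exists B, s; split=> //; left; split.
  split; rewrite ?t1 ?t2 /= ?s1 ?s2 //; last by left.
  by apply: (@stable_diag_pair _ _ _ p1 p2 p3); rewrite /= ?s1 ?s2 ?s3 ?bj ?oner_eq0.
right; right; split; rewrite ?/sigma ?/Delta ?t1 ?t2 ?t3 /= ?s1 ?s2 ?s3 //.
  split; [have := s0 i j|have := s0 i k|have := s0 j k];
  by rewrite -(similar_comm_det _ _ AB).
have /diag_mx22P[bi ci] := dB.
(* With the first term diagonal, the second upper and the third lower triangular modulo diagonals,
   the trace reduces to a single product. *)
rewrite sqrf_eq0 mxtrace22 !mxE !sum_ord2 !mulmx2E bi ci bj cj bk.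
rewrite (_ : _ + _ = (B i 0 0 - B i 1 1) * B k 1 0); last by ring.
by rewrite mulf_neq0 // subr_eq0.
Qed.
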